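(* Let $n\ge2$, $r\ge1$ and $0<q\le1$. Pick $\sigma_1,\sigma_2,\dots,\sigma_r$ independently from the Mallows model through Kendall's tau with parameter $q$ on the symmetric group $S_n$, i.e. each $\sigma\in S_n$ has probability proportional to $q^{I(\sigma)}$, where $I(\sigma)$ is the number of inversions of $\sigma$. Consider the union of their descent sets, and let $P_n(S)$ be the probability that this union equals $S=\{s_1<\dots<s_k\}\subseteq\{1,\dots,n-1\}$. Then $$P_n(S)=\det\left[\frac{1}{\left((s_{j+1}-s_i)!_q\right)^r}\right]_{i,j=0}^k,\qquad s_0=0,\ s_{k+1}=n.$$ The associated point process is stationary, one-dependent, and determinantal with correlation kernel $K(x,y)=k(y-x)$, where (as formal Laurent series) $\hat{k}(z)=\sum_{m\in\mathbb{Z}}k(m)z^m=\frac{1}{1-1/\hat{e}(z)}$ and $\hat{e}(z)=\sum_{l=0}^\infty z^l/(l!_q)^r$.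
   Context: The descent set of $\sigma\in S_n$ is $\{i\in\{1,\dots,n-1\}:\sigma(i)>\sigma(i+1)\}$. Notation: $i_q=1+q+\dots+q^{i-1}$, $m!_q=\prod_{i=1}^m i_q$ (so $0!_q=1$), and $1/m!_q=0$ for $m<0$. A point process on $\{1,\dots,n-1\}$ is a probability measure on its subsets, with correlation function $\rho(A)=P\{S:S\supseteq A\}$. It is stationary if its marginal law on $J$ equals (after translation) that on $J+i$ whenever $J,J+i\subseteq\{1,\dots,n-1\}$; one-dependent if $\rho(X\cup Y)=\rho(X)\rho(Y)$ whenever $|x-y|\ge2$ for all $x\in X,y\in Y$; determinantal with correlation kernel $K$ if $\rho(A)=\det(K(x,y))_{x,y\in A}$ for all $A$. *)

(* Defs.v *)
From mathcomp Require Import all_boot all_order all_fingroup all_algebra.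
From mathcomp Require Import all_classical reals.

Set Implicit Arguments.
Unset Strict Implicit.
Unset Printing Implicit Defensive.

Import Order.TTheory GRing.Theory Num.Theory.
Local Open Scope ring_scope.

Section QFactorial.
Variables (R : fieldType) (q : R).

Definition qint (i : nat) : R := \sum_(j < i) q ^+ j.

Definition qfact (m : nat) : R := \prod_(1 <= i < m.+1) qint i.

Definition inv_qfact (m : int) : R :=
  if m is Posz l then (qfact l)^-1 else 0.

End QFactorial.

(* The ground set {1, ..., n-1} is 'I_n.-1, where the ordinal i stands for    *)
(* the integer site i = i.+1.                                                 *)
Definition site (n : nat) (i : 'I_n.-1) : nat := i.+1.

Section Permutations.
Variable n : nat.

Lemma site_lt (i : 'I_n.-1) : (site i < n)%N.
Proof. by rewrite /site -ltn_predRL. Qed.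

(* 'S_n permutes {0, ..., n-1}: the 1-based positions site i and (site i).+1  *)
(* are the ordinals of values i and i.+1.                                     *)
Definition pos_left (i : 'I_n.-1) : 'I_n := widen_ord (leq_pred n) i.
Definition pos_right (i : 'I_n.-1) : 'I_n := Ordinal (site_lt i).

Definition descent_set (s : 'S_n) : {set 'I_n.-1} :=
  [set i | (s (pos_right i) < s (pos_left i))%N].

Definition inversions (s : 'S_n) : nat :=
  #|[set p : 'I_n * 'I_n | (p.1 < p.2)%N && (s p.2 < s p.1)%N]|.

End Permutations.

Section Mallows.
Variables (R : fieldType) (n : nat) (q : R).

Definition mallows (s : 'S_n) : R :=
  q ^+ inversions s / \sum_(t : 'S_n) q ^+ inversions t.

(* Independence: the joint law of the r permutations is the product law.      *)
Definition mallows_iid (r : nat) (s : {ffun 'I_r -> 'S_n}) : R :=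
  \prod_(j < r) mallows (s j).

Definition descent_union_law (r : nat) (S : {set 'I_n.-1}) : R :=
  \sum_(s : {ffun 'I_r -> 'S_n} | \bigcup_(j < r) descent_set (s j) == S)
    mallows_iid s.

End Mallows.

(* The sequence s_0 = 0 < s_1 < ... < s_k < s_(k+1) = n attached to           *)
(* S = {s_1 < ... < s_k}; enum lists a set of ordinals in increasing order.   *)
Definition augmented_sites (n : nat) (S : {set 'I_n.-1}) : seq nat :=
  0%N :: rcons [seq site i | i <- enum S] n.

Definition descent_union_mx (R : fieldType) (n : nat) (q : R) (r : nat)
    (S : {set 'I_n.-1}) : 'M[R]_(#|S|.+1) :=
  let s := nth 0%N (augmented_sites S) in
  \matrix_(i, j) inv_qfact q ((s j.+1)%:Z - (s i)%:Z) ^+ r.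

Section PointProcesses.
Variables (R : realType) (n : nat).
Implicit Types (P : {set 'I_n.-1} -> R) (A J T X Y : {set 'I_n.-1}).

Definition point_process P : Prop :=
  (forall S, 0 <= P S) /\ \sum_S P S = 1.

Definition correlation P A : R := \sum_(S : {set 'I_n.-1} | A \subset S) P S.

Definition marginal P J T : R := \sum_(S : {set 'I_n.-1} | S :&: J == T) P S.

Definition translatable (i : int) J : Prop :=
  forall x, x \in J -> 1 <= (site x)%:Z + i <= n.-1%:Z.

Definition translate (i : int) J : {set 'I_n.-1} :=
  [set y | [exists x in J, (site y)%:Z == (site x)%:Z + i]].

Definition stationary P : Prop :=
  forall J (i : int), translatable i J ->
  forall T, T \subset J ->
    marginal P J T = marginal P (translate i J) (translate i T).

Definition one_dependent P : Prop :=
  forall X Y,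
    (forall x y, x \in X -> y \in Y -> 2 <= `|(site x)%:Z - (site y)%:Z|) ->
    correlation P (X :|: Y) = correlation P X * correlation P Y.

Definition determinantal P (K : 'I_n.-1 -> 'I_n.-1 -> R) : Prop :=
  forall A, correlation P A =
    \det (\matrix_(i < #|A|, j < #|A|) K (enum_val i) (enum_val j)).

End PointProcesses.

(* A formal Laurent series sum_m f(m) z^m is its coefficient function         *)
(* f : int -> R, required to vanish far enough to the left.                   *)
Section Laurent.
Variable R : fieldType.
Implicit Types f g : int -> R.

Definition laurent f : Prop := exists N : int, forall m, m < N -> f m = 0.

Definition laurent_one : int -> R := fun m => (m == 0)%:R.

Definition laurent_sub f g : int -> R := fun m => f m - g m.

(* Finitely supported sum: for Laurent series f and g only finitely many i    *)
(* contribute to each coefficient.                                            *)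
Definition laurent_mul f g : int -> R :=
  fun m => \sum_(i \in [set: int]) f i * g (m - i).

Definition laurent_inverse f g : Prop :=
  [/\ laurent f, laurent g & laurent_mul f g = laurent_one].

End Laurent.

Section Kernel.
Variables (R : fieldType) (q : R) (r : nat).

Definition e_hat : int -> R :=
  fun m => if m is Posz l then (qfact q l ^+ r)^-1 else 0.

(* k is the coefficient function of 1 / (1 - 1 / e_hat).                      *)
Definition is_k_hat (k : int -> R) : Prop :=
  exists2 f, laurent_inverse e_hat f
           & laurent_inverse (laurent_sub (laurent_one R) f) k.

End Kernel.

(* Main.v *)
(* Let e(l) = 1/(l!_q)^r and E(z) = sum_l e(l) z^l. Deleting the largest value of a permutation shows that a
   Mallows permutation has no descent outside S with probability the product of 1/b!_q over the lengths b of
   the blocks into which S cuts {1, ..., n}; hence the union of the r descent sets lies in S with probability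
   the product of the e(b).
   Mark each site F (free: it cuts blocks), N (not in the set: it joins blocks) or Y (in the set: Y = F - N).
   By inclusion-exclusion the probability of every such pattern obeys one linear recursion on words. On Y/N
   words (mass function) it is the expansion of the Hessenberg determinant along its first column. Y/F words
   (correlation function) split at every F, which gives one-dependence and, since e(1) = 1, translation
   invariance. A run of l letters Y weighs (-1)^(l+1) times the coefficient of z^(l+1) in 1/E(z); as the series
   of k is inverse to 1 - 1/E(z), this is the l x l determinant of k(y - x), which in general is block
   triangular along the maximal runs of consecutive sites. *)
Require Import Defs.
From mathcomp Require Import all_boot all_order all_fingroup all_algebra.
From mathcomp Require Import all_classical reals.
From mathcomp Require Import zify ring.

Set Implicit Arguments.
Unset Strict Implicit.
Unset Printing Implicit Defensive.

Import Order.TTheory GRing.Theory Num.Theory.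
Local Open Scope ring_scope.

(** * Weights of words in the letters Y, N and F *)

Section Words.
Variables (R : comNzRingType) (e : nat -> R).
Implicit Types (b : nat) (w : seq (option bool)).

(* Letters: None = F, Some false = N, Some true = Y; [b] is the length of the current block so far. *)
Fixpoint word_weight b w : R :=
  match w with
  | [::] => e b
  | None :: w' => e b * word_weight 1 w'
  | Some false :: w' => word_weight b.+1 w'
  | Some true :: w' => e b * word_weight 1 w' - word_weight b.+1 w'
  end.

(** A letter F always closes the current block, so what follows starts afresh with a block of length
    1. *)
Lemma word_weight_free b w1 w2 :
  word_weight b (w1 ++ None :: w2) = word_weight b w1 * word_weight 1 w2.
Proof.
by elim: w1 b => [|[[]|] w1 IH] b //=; rewrite !IH; ring.
Qed.

Lemma word_weight_true b w1 w2 :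
  word_weight b (w1 ++ Some true :: w2) =
  word_weight b (w1 ++ None :: w2) - word_weight b (w1 ++ Some false :: w2).
Proof.
by elim: w1 b => [|[[]|] w1 IH] b //=; rewrite !IH; ring.
Qed.

Lemma word_weight_nseq_cat m w :
  e 1 = 1 -> word_weight 1 (nseq m None ++ w) = word_weight 1 w.
Proof. by move=> e1; elim: m => //= m ->; rewrite e1 mul1r. Qed.

Lemma word_weight_cat_nseq m b w :
  e 1 = 1 -> word_weight b (w ++ nseq m None) = word_weight b w.
Proof.
move=> e1; elim: m => [|m IH]; first by rewrite cats0.
have := word_weight_nseq_cat m [::] e1; rewrite cats0 /= e1 => nseq1.
by rewrite word_weight_free nseq1 mulr1.
Qed.

Lemma word_weight_map_shift b (w w' : nat -> option bool) a a' m :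
  (forall j, (j < m)%N -> w (a + j)%N = w' (a' + j)%N) ->
  word_weight b (map w (iota a m)) = word_weight b (map w' (iota a' m)).
Proof.
move=> ww'; congr (word_weight b _).
apply: (@eq_from_nth _ None); rewrite !size_map !size_iota // => j jm.
by rewrite !(nth_map 0%N) ?size_iota // !nth_iota // ww'.
Qed.

Definition corr_word (A : nat -> bool) a m : seq (option bool) :=
  [seq if A i then Some true else None | i <- iota a m].

Lemma corr_wordS A a m :
  corr_word A a m.+1 =
  (if A a then Some true else None) :: corr_word A a.+1 m.
Proof. by []. Qed.

(** Induction along the word. The current block of length [b] is charged to [X], which is why [Y]
    must avoid the first site. *)
Lemma corr_word_weight_disjoint (X Y : nat -> bool) b a m :
  e 1 = 1 ->
  (forall i j, X i -> Y j -> (i + 1 < j)%N || (j + 1 < i)%N) ->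
  ~~ Y a ->
  word_weight b (corr_word (predU X Y) a m) =
  word_weight b (corr_word X a m) * word_weight 1 (corr_word Y a m).
Proof.
move=> e1; elim: m X Y b a => [|m IH] X Y b a XY Ya; first by rewrite /= e1 mulr1.
have YX i j : Y i -> X j -> (i + 1 < j)%N || (j + 1 < i)%N.
  by move=> Yi Xj; rewrite orbC XY.
rewrite !corr_wordS /= (negbTE Ya) orbF /= e1 mul1r.
have UC : predU X Y =1 predU Y X by move=> i /=; rewrite orbC.
have IH1 : word_weight 1 (corr_word (predU X Y) a.+1 m) =
  word_weight 1 (corr_word X a.+1 m) * word_weight 1 (corr_word Y a.+1 m).
  (* The block now has length 1, so [X] and [Y] may exchange roles when the next site belongs to
     [Y]. *)
  case: (boolP (Y a.+1)) => Ya1; last exact: IH.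
  rewrite mulrC -IH //; last by apply/negP => Xa1; have := XY _ _ Xa1 Ya1; lia.
  by congr word_weight; apply: eq_map => i; rewrite UC.
case: ifP => Xa /=; last by rewrite IH1 mulrA.
rewrite IH1 IH //; first by rewrite mulrBl mulrA.
by apply/negP => Ya1; have := XY _ _ Xa Ya1; lia.
Qed.

Definition run l : seq (option bool) := nseq l (Some true).

(* The coefficients of the formal power series 1 / sum_l e(l) z^l, when e(0) = 1. *)
Definition series_inv m : R :=
  if m is l.+1 then (-1) ^+ m * word_weight 1 (run l) else 1.

(** The index [i] counts the letters that lengthen the block before it is first closed; a shorter
    run from a fresh block remains, or nothing when i = l. *)
Lemma run_weight b l :
  word_weight b (run l) =
  (-1) ^+ l * \sum_(i < l.+1) e (b + i) * series_inv (l - i).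
Proof.
elim: l b => [|l IH] b; first by rewrite big_ord1 /= addn0 mulr1 mul1r.
rewrite big_ord_recl /= addn0 (IH b.+1) /= subn0.
rewrite mulrDr; congr (_ + _).
  by rewrite mulrCA signrMK.
rewrite exprS mulN1r mulNr; congr (- (_ * _)).
by apply: eq_bigr => i _; rewrite addSnnS subSS.
Qed.

Lemma series_invP m :
  e 0 = 1 -> \sum_(i < m.+1) e i * series_inv (m - i) = (m == 0)%:R.
Proof.
move=> e0; case: m => [|l]; first by rewrite big_ord1 e0 mulr1.
rewrite big_ord_recl e0 mul1r /= run_weight exprS mulN1r mulNr signrMK addrC.
by apply/eqP; rewrite subr_eq0; apply/eqP; apply: eq_bigr => i _.
Qed.

Lemma conv_inj (a b c : nat -> R) :
  a 0 = 1 ->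
  (forall m, \sum_(i < m.+1) a i * b (m - i)%N = \sum_(i < m.+1) a i * c (m - i)%N) ->
  b =1 c.
Proof.
move=> a0 H m; elim/ltn_ind: m => m IH.
have := H m; rewrite !big_ord_recl /= a0 !mul1r subn0.
rewrite (eq_bigr (fun i : 'I_m => a (lift ord0 i) * c (m - lift ord0 i)%N)).
  by move/addIr.
by move=> i _; rewrite IH //= /bump; have := ltn_ord i; lia.
Qed.

End Words.

(** * Determinants of Hessenberg matrices *)

Section Hessenberg.
Variables (R : comNzRingType) (T : Type) (K : T -> T -> R).

Fixpoint hess (x c : T) (ps : seq (T * T)) : R :=
  if ps is (r, c') :: ps' then K x c * hess r c' ps' - K r c * hess x c' ps'
  else K x c.

(* [hess x c ps] expands, along its first column, the determinant with rows x, (p.1)_p and columns c, (p.2)_p. *)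
Lemma hess_det (d x c : T) (ps : seq (T * T)) :
  (forall i j, (j.+1 < i)%N -> (i <= size ps)%N ->
     K (nth d (x :: unzip1 ps) i) (nth d (c :: unzip2 ps) j) = 0) ->
  hess x c ps =
  \det (\matrix_(i < (size ps).+1, j < (size ps).+1)
          K (nth d (x :: unzip1 ps) i) (nth d (c :: unzip2 ps) j)).
Proof.
elim: ps x c => [|[r c'] ps IH] x c H /=; first by rewrite det_mx11 mxE.
(* Only the two top entries of the first column survive; deleting their rows leaves matrices of the
   same shape with first row [r] and [x] respectively. *)
rewrite (expand_det_col _ ord0) !big_ord_recl big1 ?addr0; last first.
  by move=> i _; rewrite mxE H ?mul0r //=; have := ltn_ord i; rewrite /bump; lia.
rewrite !mxE /= /cofactor /= expr0 mul1r expr1 !IH => [||].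
- congr (_ * _ + _).
    by congr (\det _); apply/matrixP => i j; rewrite !mxE.
  rewrite mulN1r mulrN; congr (- (_ * _)).
  congr (\det _); apply/matrixP => i j; rewrite !mxE /=.
  by case: i => [[|i] ?].
- move=> [|i] // j ji ip; apply: (H i.+2 j.+1); rewrite //= ltnS.
- by move=> i j ji ip; apply: (H i.+1 j.+1).
Qed.

End Hessenberg.

(** For matrices whose sizes are provably equal but not convertible. *)
Lemma det_eq_entries (R : comNzRingType) n m (A : 'M[R]_n) (B : 'M[R]_m) :
  n = m ->
  (forall (i j : 'I_n) (i' j' : 'I_m), i = i' :> nat -> j = j' :> nat ->
     A i j = B i' j') ->
  \det A = \det B.
Proof.
by move=> nm; case: m / nm B => B H; congr (\det _); apply/matrixP => i j; apply: H.
Qed.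

(** * Word weights as determinants *)

Section WordDeterminants.
Variable R : comNzRingType.

Definition toeplitz (e : nat -> R) (x y : nat) : R :=
  if (x <= y)%N then e (y - x)%N else 0.

Lemma toeplitzE e x y : (x <= y)%N -> toeplitz e x y = e (y - x)%N.
Proof. by rewrite /toeplitz => ->. Qed.

Lemma toeplitz_eq0 e x y : (y < x)%N -> toeplitz e x y = 0.
Proof. by move=> yx; rewrite /toeplitz leqNgt yx. Qed.

(** Here [x] is the last cut and [L] lists the later ones. The subdiagonal entries are e(0) = 1, so
    the expansion of [hess] is the recursion for a letter Y. *)
Lemma word_weight_hess (e : nat -> R) (S : nat -> bool) x a m :
  e 0 = 1 -> (x <= a)%N ->
  word_weight e (a.+1 - x) [seq Some (S i) | i <- iota a m] =
  let L := rcons [seq i.+1 | i <- iota a m & S i] (a + m).+1 in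
  hess (toeplitz e) x (head 0%N L) (zip L (behead L)).
Proof.
move=> e0; elim: m x a => [|m IH] x a xa /=.
  by rewrite addn0 toeplitzE // leqW.
rewrite -subSn ?leqW // addnS -addSn.
have IHx := IH x a.+1 (leqW xa); have IHa := IH a.+1 a.+1 (leqnn _).
rewrite subSnn in IHa.
rewrite IHx /=; case: (S a) => //=; rewrite IHa /= headI /=.
by rewrite !toeplitzE ?(leqW xa) // subnn e0 mul1r.
Qed.

Variables (e k : nat -> R).
Hypothesis (e1 : e 1 = 1) (k0 : k 0 = 1).
Hypothesis ek : forall l,
  word_weight k 1 (run l) = word_weight e 1 (run l.+1).

(** The Laurent series of the kernel starts in degree -1, hence the shift: [k l] is its coefficient
    of degree l - 1. *)
Let K x y := toeplitz k x y.+1.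
Definition corr_det (L : seq nat) : R :=
  if L is c :: L' then hess K c c (zip L' L') else 1.

(* The second part is what the induction carries: a maximal run of l + 1 letters Y at the current site *)
(* factors out of both sides, as a word weight for e and as a word weight for k with one letter less. *)
Let run_claim (A : nat -> bool) m a :
  word_weight e 1 (corr_word A a m) = corr_det [seq i <- iota a m | A i] /\
  ((0 < m)%N -> A a -> exists l v,
   (forall b, word_weight e b (corr_word A a m) =
              word_weight e b (run l.+1) * v) /\
   (forall x, (x <= a)%N ->
    let L' := [seq i <- iota a.+1 m.-1 | A i] in
    hess K x a (zip L' L') = word_weight k (a - x).+1 (run l) * v)).
Proof.
elim: m a => [|m IH] a; first by rewrite /= e1; split.
have {IH} [IH1 IH2] := IH a.+1.
(* The second part implies the first: take x = a and convert the weight of the run by [ek]. *)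
set Q := (X in _ /\ X); suff HQ : Q.
  split=> //; case: (boolP (A a)) HQ => Aa; last first.
    by rewrite corr_wordS /= (negbTE Aa) /= e1 mul1r IH1.
  by case=> // l [v [H1 /(_ a (leqnn a)) H2]]; rewrite H1 -ek /= Aa [RHS]H2 subnn.
rewrite {}/Q => _ Aa; rewrite corr_wordS Aa /=.
(* If the next site is in [A], the run grows by one letter, and the subdiagonal entry k(0) = 1 makes
   both recursions agree. *)
case: (boolP ((0 < m)%N && A a.+1)) => [/andP[m0 Aa1]|H].
  have {IH2} [//|//|l [v [H1 H2]]] := IH2; exists l.+1, v; split=> [b|x xa].
    by rewrite /= !H1 /=; ring.
  have L'E : [seq i <- iota a.+1 m | A i] = a.+1 :: [seq i <- iota a.+2 m.-1 | A i].
    by case: m m0 {IH1 H1 H2} => //= m _; rewrite Aa1.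
  rewrite L'E /= (H2 _ (leqnn _)) (H2 _ (leqW xa)) subnn.
  by rewrite /K !toeplitzE ?(leqW xa) // subnn k0 !subSn ?(leqW xa) //; ring.
(* Otherwise the run stops here: the block is closed by a letter F or by the end of the word. *)
have wF b : word_weight e b (corr_word A a.+1 m) =
    e b * word_weight e 1 (corr_word A a.+1 m).
  case: m H {IH1 IH2} => [|m] /= H; first by rewrite e1 mulr1.
  by rewrite (negbTE H) /= e1 mul1r.
exists 0%N, (word_weight e 1 (corr_word A a.+1 m)); split=> [b|x xa].
  by rewrite (wF b.+1) /= e1; ring.
rewrite IH1 /=.
(* The next element of [A] leaves a gap, so the subdiagonal entry vanishes and the determinant
   splits. *)
have: forall c, c \in [seq i <- iota a.+1 m | A i] -> (a.+1 < c)%N.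
  move=> c; rewrite mem_filter mem_iota => /andP[Ac /andP[ac cm]].
  rewrite ltn_neqAle ac andbT; apply/eqP => acE.
  by move: H; rewrite acE Ac andbT -ltnNge; lia.
case: [seq i <- _ | _] => [|c L] Lc /=; rewrite [K x a]toeplitzE ?(leqW xa) // subSn // ?mulr1 //.
by rewrite [K c a]toeplitz_eq0 ?Lc ?mem_head // mul0r subr0.
Qed.

Lemma corr_word_det (A : nat -> bool) m a :
  word_weight e 1 (corr_word A a m) = corr_det [seq i <- iota a m | A i].
Proof. by have [] := run_claim A m a. Qed.

(** In an increasing list, entries two places apart differ by at least 2, so [K] vanishes below the
    subdiagonal. *)
Lemma corr_det_det (L : seq nat) :
  sorted ltn L ->
  corr_det L = \det (\matrix_(i < size L, j < size L) K (nth 0%N L i) (nth 0%N L j)).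
Proof.
case: L => [|c L] sL; first by rewrite det_mx00.
rewrite [LHS](@hess_det _ _ _ 0%N); last first.
  move=> i j ji; rewrite size_zip minnn => iL; rewrite unzip1_zip ?unzip2_zip // /K toeplitz_eq0 //.
  have ltL a b : (a < b)%N -> (b <= size L)%N -> (nth 0%N (c :: L) a < nth 0%N (c :: L) b)%N.
    move=> ab bL; apply: (sorted_ltn_nth ltn_trans) => //; rewrite inE /=; lia.
  by apply: leq_ltn_trans (ltL _ _ ji _); rewrite // ltL //; lia.
apply: det_eq_entries; first by rewrite size_zip minnn.
move=> i j i' j' ii' jj'; rewrite !mxE unzip1_zip ?unzip2_zip //.
by rewrite ii' jj'.
Qed.

End WordDeterminants.

(** * Mallows weight of the permutations with descents only at block ends *)

Section MallowsDescents.
Variables (R : fieldType) (q : R).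
Implicit Types (t : nat -> bool) (n : nat).

Definition desc_in t n (s : 'S_n) : bool :=
  [forall a : 'I_n, forall b : 'I_n, ((b == a.+1 :> nat) && (s b < s a)%N) ==> t a].

Lemma desc_inP t n (s : 'S_n) :
  reflect (forall a b : 'I_n, b = a.+1 :> nat -> (s b < s a)%N -> t a) (desc_in t s).
Proof.
apply: (iffP forallP) => H a.
  by move=> b ba sba; have /forallP/(_ b) := H a; rewrite ba sba eqxx.
by apply/forallP => b; apply/implyP => /andP[/eqP ba sba]; apply: H ba sba.
Qed.

(* The 1-based rank of position a in its block, when [t a] means that a block ends at position a. *)
Fixpoint block_pos t a : nat :=
  if a is a'.+1 then if t a' then 1 else (block_pos t a').+1 else 1.

(* The block ends that remain once position i, a block end, is deleted; the positions i - 1 and i + 1 *)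
(* that become adjacent are separated, because the values around a maximum may be in any order. *)
Definition tdel t i a := if (a.+1 < i)%N then t a else (a.+1 == i) || t a.+1.

Lemma block_pos_tdel_lt t i a : (a < i)%N -> block_pos (tdel t i) a = block_pos t a.
Proof. by elim: a => //= a IH ai; rewrite {1}/tdel ai IH // ltnW. Qed.

Lemma block_pos_tdel_ge t i a :
  t i -> (i <= a)%N -> block_pos (tdel t i) a = block_pos t a.+1.
Proof.
move=> ti; elim: a => [|a IH].
  by rewrite leqn0 => /eqP i0 /=; move: ti; rewrite i0 => ->.
rewrite leq_eqVlt => /orP[/eqP ia|ia].
  by move: ti {IH}; rewrite ia => ti; rewrite [RHS]/= ti /= /tdel ltnn eqxx.
have ta : tdel t i a = t a.+1 by rewrite /tdel (gtn_eqF ia) ltnNge ltnW.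
by rewrite [LHS]/= IH // ta.
Qed.

(** Deleting the last position of a block changes no other rank, so exactly one factor is lost. *)
Lemma block_pos_prod t n (i : 'I_n.+1) :
  (i == ord_max) || t i ->
  \prod_(a < n.+1) qint q (block_pos t a) =
  qint q (block_pos t i) * \prod_(a < n) qint q (block_pos (tdel t i) a).
Proof.
move=> it; rewrite (bigD1_ord i) //=; congr (_ * _); apply: eq_bigr => a _.
rewrite /= /bump; case: leqP => ia /=; last by rewrite block_pos_tdel_lt.
rewrite block_pos_tdel_ge //; case/orP: it => // /eqP iE.
by move: ia; rewrite iE leqNgt ltn_ord.
Qed.

Lemma inversionsE n (s : 'S_n) :
  inversions s = (\sum_(a < n) \sum_(b < n) ((a < b) && (s b < s a)))%N.
Proof.
rewrite /inversions -sum1_card pair_big /= big_mkcond /=.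
by apply: eq_bigr => -[a b] _; rewrite inE /=; case: (_ && _).
Qed.

Lemma sum_geq_ord n i : (i <= n)%N -> (\sum_(b < n) (i <= b))%N = (n - i)%N.
Proof.
move=> ni; rewrite -(big_mkord xpredT (fun b => (i <= b)%N : nat)).
rewrite (big_cat_nat (n := i)) //= big_nat_cond big1 ?add0n; last first.
  by move=> b /andP[/andP[_ bi] _]; rewrite leqNgt bi.
rewrite big_nat_cond (eq_bigr (fun=> 1%N)); last by move=> b /andP[/andP[->]].
by rewrite -big_nat_cond sum_nat_const_nat muln1.
Qed.

(** The maximum inserted at position [i] is inverted with each of the n - i later entries and with
    no earlier one. *)
Lemma inversions_lift n (i : 'I_n.+1) (s : 'S_n) :
  inversions (lift_perm i ord_max s) = (inversions s + (n - i))%N.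
Proof.
rewrite !inversionsE (bigD1_ord i) //= addnC; congr (_ + _)%N.
  apply: eq_bigr => a _; rewrite (bigD1_ord i) //= lift_perm_id lift_perm_lift.
  rewrite lift_max [(_ < s a)%N]ltnNge [(s a <= _)%N]ltnW // andbF add0n.
  apply: eq_bigr => b _; rewrite lift_perm_lift !lift_max.
  by rewrite !ltnNge leq_bump2.
rewrite (bigD1_ord i) //= ltnn add0n -(@sum_geq_ord n i (ltn_ord i)).
apply: eq_bigr => b _; rewrite lift_perm_id lift_perm_lift lift_max ltn_ord andbT.
by rewrite /bump; case: leqP; lia.
Qed.

(** The maximum makes a descent with its right neighbour, if there is one, and never with its left
    neighbour. *)
Lemma desc_in_lift t n (i : 'I_n.+1) (s : 'S_n) :
  desc_in t (lift_perm i ord_max s) =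
  ((i == ord_max) || t i) && desc_in (tdel t i) s.
Proof.
apply/desc_inP/andP => [H|[it /desc_inP H] a b].
  split; last first.
    apply/desc_inP => a b ba sba; have := H (lift i a) (lift i b).
    rewrite !lift_perm_lift !lift_max /= => /(_ _ sba); rewrite /tdel /bump ba.
    case: (leqP i a) => c1; case: (leqP i a.+1) => c2; case: (ltngtP a.+1 i) => c3.
    all: rewrite ?add0n ?add1n ?orbT ?orbF //=; try lia.
  case: eqP => //= /eqP iM.
  have Hi : (i.+1 < n.+1)%N.
    by rewrite ltn_neqAle ltn_ord andbT; apply: contraNneq iM => iE; apply/eqP/val_inj; case: iE.
  apply: (H i (Ordinal Hi)) => //.
  have [j jE|] := unliftP i (Ordinal Hi); last by move/(congr1 val) => /=; lia.
  by rewrite jE lift_perm_id lift_perm_lift lift_max /=.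
have [a' ->|->] := unliftP i a; have [b' ->|->] := unliftP i b.
- rewrite !lift_perm_lift !lift_max => ba sba.
  have ba' : b' = a'.+1 :> nat by move: ba; rewrite /= /bump; do 2!case: leqP; lia.
  have := H _ _ ba' sba; move: ba; rewrite /tdel /= /bump ba'.
  case: (leqP i a') => c1; case: (leqP i a'.+1) => c2; case: (ltngtP a'.+1 i) => c3.
  all: rewrite ?add0n ?add1n ?orbT ?orbF //=; try lia.
- by rewrite lift_perm_id lift_perm_lift lift_max ltnNge ltnW //= -ltnS.
- by move=> /= iE _; case/orP: it => // /eqP iM; move: (ltn_ord (lift i b')); rewrite /= iE iM ltnn.
Qed.

Lemma qintS i : qint q i.+1 = 1 + q * qint q i.
Proof.
rewrite /qint big_ord_recl expr0 mulr_sumr; congr (_ + _).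
by apply: eq_bigr => j _; rewrite -exprS.
Qed.

(** A block of length l ending at i contributes the powers of q from n - i to n - i + l - 1;
    together the blocks use each exponent from 0 to n once. *)
Lemma qint_block_sum t n :
  \sum_(i < n | t i) q ^+ (n - i) * qint q (block_pos t i) + qint q (block_pos t n) =
  qint q n.+1.
Proof.
elim: n => [|n IH]; first by rewrite big_ord0 add0r.
rewrite qintS -IH big_mkcond big_ord_recr /= -big_mkcond /= subSnn expr1.
rewrite (eq_bigr (fun i : 'I_n => q * (q ^+ (n - i) * qint q (block_pos t i)))).
  rewrite -mulr_sumr; case: (t n); last by rewrite qintS; ring.
  by rewrite /(qint q 1) big_ord1; ring.
by move=> i _; rewrite subSn 1?ltnW // exprS mulrA.
Qed.

Lemma perm_max_reindex n (F : 'S_n.+1 -> R) :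
  \sum_s F s = \sum_(i < n.+1) \sum_(s : 'S_n) F (lift_perm i ord_max s).
Proof.
rewrite pair_big /=; apply: (reindex (fun p => lift_perm p.1 ord_max p.2)).
apply/onW_bij/inj_card_bij; last by rewrite card_prod card_ord !card_Sn factS.
move=> [i s] [j t] /= H.
have ij : i = j.
  apply: (@perm_inj _ (lift_perm j ord_max t)).
  by rewrite -{1}H !lift_perm_id.
rewrite -ij in H *; congr (_, _); apply/permP => k; apply: (@lift_inj _ ord_max).
by rewrite -!(lift_perm_lift i) H.
Qed.

(** Split by the position [i] of the maximum and apply induction to [tdel t i]; the weights of the
    positions add up by [qint_block_sum]. Keeping the product on the left avoids dividing by
    q-integers. *)
Lemma sum_desc_in t n :
  (\sum_(s : 'S_n | desc_in t s) q ^+ inversions s) *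
    \prod_(a < n) qint q (block_pos t a) = qfact q n.
Proof.
elim: n t => [|n IH] t.
  rewrite big_ord0 mulr1 /qfact big_nil (big_pred1 1%g) => [|s].
    by rewrite inversionsE big_ord0.
  have -> : s = 1%g by apply/permP; case.
  by rewrite /= eqxx; apply/desc_inP; case.
rewrite big_mkcond perm_max_reindex mulr_suml.
transitivity ((\sum_(i < n.+1 | (i == ord_max) || t i)
   q ^+ (n - i) * qint q (block_pos t i)) * qfact q n).
  rewrite [in RHS]big_mkcond mulr_suml; apply: eq_bigr => i _.
  under eq_bigr do rewrite desc_in_lift inversions_lift exprD.
  case: ifP => it /=; last by rewrite big1 ?mul0r.
  by rewrite -big_mkcond -mulr_suml (block_pos_prod it) -(IH (tdel t i)) /=; ring.
rewrite big_mkcond big_ord_recr /= eqxx subnn mul1r.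
rewrite (eq_bigr (fun i : 'I_n =>
    if t i then q ^+ (n - i) * qint q (block_pos t i) else 0)).
  by rewrite -big_mkcond qint_block_sum mulrC /qfact [in RHS]big_nat_recr.
by move=> i _; rewrite -val_eqE /= ltn_eqF.
Qed.

End MallowsDescents.

(** * Inclusion-exclusion: from subset sums to arbitrary patterns *)

Section SetWords.
Variables (n : nat).
Implicit Types (S T A : {set 'I_n}) (w : nat -> option bool).

Definition set_pred S (a : nat) : bool := oapp (fun i : 'I_n => i \in S) false (insub a).

Lemma set_predE S (i : 'I_n) : set_pred S i = (i \in S).
Proof. by rewrite /set_pred valK. Qed.

Lemma set_pred_ord S a : set_pred S a -> exists2 i : 'I_n, i \in S & i = a :> nat.
Proof. by rewrite /set_pred; case: insubP => //= i _ ia iS; exists i. Qed.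

Lemma map_val_enum S : [seq val i | i <- enum S] = [seq a <- iota 0 n | set_pred S a].
Proof.
rewrite -val_enum_ord filter_map; congr map; rewrite {1}/enum_mem -enumT.
by apply: eq_filter => i; rewrite /= set_predE.
Qed.

Definition agree w S : bool :=
  [forall i : 'I_n, if w i is Some b then (i \in S) == b else true].

Lemma agreeP w S :
  reflect (forall (i : 'I_n) b, w i = Some b -> (i \in S) = b) (agree w S).
Proof.
apply: (iffP forallP) => H i; first by move=> b wi; move: (H i); rewrite wi => /eqP.
by case: (w i) (H i) => // b /(_ b erefl) ->.
Qed.

Variables (R : comNzRingType) (e : nat -> R) (P : {set 'I_n} -> R).

Hypothesis sub_sum : forall S, \sum_(T : {set 'I_n} | T \subset S) P T =
  word_weight e 1 [seq if set_pred S i then None else Some false | i <- iota 0 n].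

Lemma agree_sum w :
  \sum_(S | agree w S) P S = word_weight e 1 [seq w i | i <- iota 0 n].
Proof.
(* Induction on a bound [m] for the positions that carry a letter Y. *)
have H m : (m <= n)%N ->
    forall w, (forall i, (m <= i < n)%N -> w i <> Some true) ->
    \sum_(S | agree w S) P S = word_weight e 1 [seq w i | i <- iota 0 n].
  elim: m => [|m IH] mn {}w wY.
    (* Without Y, agreeing with the word means being contained in the set of its F sites. *)
    pose T := [set i : 'I_n | w i == None].
    rewrite (eq_bigl (fun S => S \subset T)) ?sub_sum => [|S].
      congr word_weight; apply/eq_in_map => i; rewrite mem_iota /= => /= ni.
      have := wY i ni; rewrite -[i]/(val (Ordinal ni)) set_predE inE /=.
      by case: (w i) => [[]|].
    apply/agreeP/fintype.subsetP => [H i iS|H i b wi].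
      have := wY i (ltn_ord i); have := H i; rewrite inE.
      by case: (w i) => // -[] // /(_ _ erefl); rewrite iS.
    have := wY i (ltn_ord i); case: b wi => // wi _.
    by apply/negbTE/negP => /H; rewrite inE wi.
  case: (boolP (w m == Some true)) => [/eqP wm|wm]; last first.
    apply: (IH (ltnW mn)) => i; case: (eqVneq i m) => [-> _|im imn]; first exact/eqP.
    by apply: wY; lia.
  pose u v i := if i == m then v else w i.
  have uY v : v <> Some true -> forall i, (m <= i < n)%N -> u v i <> Some true.
    by move=> vY i imn; rewrite /u; case: eqP => // im; apply: wY; lia.
  have u_ne v i : i != m -> u v i = w i by rewrite /u => /negbTE->.
  have map_u v : [seq u v i | i <- iota 0 n] =
      [seq w i | i <- iota 0 m] ++ v :: [seq w i | i <- iota m.+1 (n - m.+1)].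
    have -> : iota 0 n = iota 0 m ++ m :: iota m.+1 (n - m.+1).
      by rewrite -[m in m :: _]add0n -[_ :: _]/(iota (0 + m) (n - m.+1).+1) -iotaD; congr iota; lia.
    rewrite map_cat /= {2}/u eqxx; congr (_ ++ _ :: _); apply/eq_in_map => i;
      by rewrite mem_iota => im; rewrite u_ne //; lia.
  have wE : [seq w i | i <- iota 0 n] = [seq u (Some true) i | i <- iota 0 n].
    by apply: eq_map => i; rewrite /u; case: eqP => // ->.
  rewrite wE map_u word_weight_true -!map_u -!(IH (ltnW mn)) //; try exact: uY.
  apply/esym/eqP; rewrite subr_eq; apply/eqP.
  pose M := Ordinal mn.
  (* Sets that are free at [m] either contain it (letter Y) or miss it (letter N). *)
  rewrite (bigID (fun S => M \in S)) /=; congr (_ + _); apply: eq_bigl => S.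
    apply/andP/agreeP => [[/agreeP H MS] i b|H].
      case: (eqVneq i M) => [->|iM]; first by rewrite wm => -[<-].
      by move=> wi; apply: H; rewrite u_ne.
    split; last exact: (H M true wm).
    apply/agreeP => i b; case: (eqVneq i M) => [->|iM]; first by rewrite /u eqxx.
    by rewrite u_ne //; apply: H.
  apply/andP/agreeP => [[/agreeP H MS] i b|H].
    case: (eqVneq i M) => [->|iM]; first by rewrite /u eqxx => -[<-]; apply/negbTE.
    by rewrite u_ne // => wi; apply: H; rewrite u_ne.
  split; last by rewrite (H M false) // /u eqxx.
  apply/agreeP => i b; case: (eqVneq i M) => [->|iM]; first by rewrite /u eqxx.
  by move=> ui; apply: H; move: ui; rewrite !u_ne.
by apply: (H n) => // i /andP[ni]; rewrite ltnNge ni.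
Qed.

Lemma mass_word S :
  P S = word_weight e 1 [seq Some (set_pred S i) | i <- iota 0 n].
Proof.
rewrite -agree_sum (big_pred1 S) // => T; apply/agreeP/eqP => [H|-> i b [<-]].
  by apply/setP => i; rewrite (H i (set_pred S i)) // set_predE.
by rewrite set_predE.
Qed.

Lemma superset_sum_word A :
  \sum_(S : {set 'I_n} | A \subset S) P S = word_weight e 1 (corr_word (set_pred A) 0 n).
Proof.
rewrite -agree_sum; apply: eq_bigl => S; apply/fintype.subsetP/agreeP => H i.
  by move=> b; case: ifP => //; rewrite set_predE => iA [<-]; apply: H.
by move=> iA; apply: H; rewrite set_predE iA.
Qed.

End SetWords.

Lemma descent_subset n (s : 'S_n.+1) (S : {set 'I_n}) :
  (descent_set s \subset S) = desc_in (set_pred S) s.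
Proof.
apply/fintype.subsetP/desc_inP => [H a b ba sba|H i].
  have an : (a < n)%N by rewrite -ltnS -ba.
  rewrite -[a : nat]/(val (Ordinal an)) set_predE; apply: H; rewrite inE.
  have -> : @pos_right n.+1 (Ordinal an) = b by apply: val_inj; rewrite /= /site ba.
  by have -> : @pos_left n.+1 (Ordinal an) = a by apply: val_inj.
by rewrite inE -(set_predE S) => si; apply: (H (@pos_left n.+1 i) (@pos_right n.+1 i)).
Qed.

(** Each position that joins a block multiplies its weight by one factor [h], so the block weights
    spread over the positions. *)
Lemma word_weight_blocks (R : comNzRingType) (e h : nat -> R) t a m :
  e 1 = 1 -> h 1 = 1 -> (forall b, e b.+1 = e b * h b.+1) ->
  word_weight e (block_pos t a) [seq if t i then None else Some false | i <- iota a m] =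
  e (block_pos t a) * \prod_(a <= j < a + m) h (block_pos t j.+1).
Proof.
move=> e1 h1 eh; elim: m a => [|m IH] a; first by rewrite addn0 big_geq ?mulr1.
rewrite big_ltn ?addnS ?ltnS ?leq_addr // -addSn /=.
have {}IH := IH a.+1; rewrite /= in IH; case: (t a) IH => /= IH.
  by rewrite IH e1 h1 !mul1r.
by rewrite IH eh mulrA.
Qed.

(** * The law of the union of the descent sets *)

Section DescentUnion.
Variables (R : realFieldType) (q : R) (n r : nat).
Hypothesis q_gt0 : 0 < q.
Implicit Types S T : {set 'I_n}.

Definition block_weight l : R := (qfact q l ^+ r)^-1.

Lemma qint_gt0 i : 0 < qint q i.+1.
Proof.
rewrite /qint big_ord_recl expr0 ltr_pwDl // sumr_ge0 // => j _.
by rewrite exprn_ge0 // ltW.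
Qed.

Lemma qfact_gt0 m : 0 < qfact q m.
Proof.
elim: m => [|m IH]; first by rewrite /qfact big_nil.
by rewrite /qfact big_nat_recr //= mulr_gt0 // qint_gt0.
Qed.

Lemma block_weight0 : block_weight 0 = 1.
Proof. by rewrite /block_weight /qfact big_nil expr1n invr1. Qed.

Lemma block_weight1 : block_weight 1 = 1.
Proof. by rewrite /block_weight /qfact big_nat1 /qint big_ord1 !expr1n invr1. Qed.

Lemma block_weightS b :
  block_weight b.+1 = block_weight b * (qint q b.+1 ^+ r)^-1.
Proof. by rewrite /block_weight /qfact big_nat_recr //= exprMn invfM. Qed.

Lemma mallows_desc_in t :
  \sum_(s : 'S_n.+1 | desc_in t s) mallows q s =
  \prod_(a < n.+1) (qint q (block_pos t a))^-1.
Proof.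
have bp_gt0 t' a : 0 < qint q (block_pos t' a).
  by case: a => [|a] /=; rewrite ?qint_gt0 //; case: ifP; rewrite qint_gt0.
have W t' : \sum_(s : 'S_n.+1 | desc_in t' s) q ^+ inversions s =
    qfact q n.+1 * \prod_(a < n.+1) (qint q (block_pos t' a))^-1.
  rewrite -(sum_desc_in q t' n.+1) prodfV mulfK // gt_eqF //.
  by apply: prodr_gt0 => a _.
have -> : \sum_(s : 'S_n.+1 | desc_in t s) mallows q s =
    (\sum_(s : 'S_n.+1 | desc_in t s) q ^+ inversions s) /
    \sum_(s : 'S_n.+1) q ^+ inversions s by rewrite mulr_suml.
(* The normalizing constant is the case where every position ends a block, so that all ranks are
   1. *)
have -> : \sum_(s : 'S_n.+1) q ^+ inversions s = qfact q n.+1.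
  transitivity (\sum_(s : 'S_n.+1 | desc_in xpredT s) q ^+ inversions s).
    by apply: eq_bigl => s; apply/esym/desc_inP.
  rewrite W big1 ?mulr1 // => a _.
  have -> : block_pos xpredT a = 1%N by case: (a : nat).
  by rewrite /qint big_ord1 invr1.
by rewrite W mulrC mulKf // gt_eqF // qfact_gt0.
Qed.

Lemma law_subset S :
  \sum_(T : {set 'I_n} | T \subset S) @descent_union_law R n.+1 q r T =
  word_weight block_weight 1
    [seq if set_pred S i then None else Some false | i <- iota 0 n].
Proof.
have h1 : (qint q 1 ^+ r)^-1 = 1 :> R by rewrite /qint big_ord1 !expr1n invr1.
have := @word_weight_blocks _ _ (fun b => (qint q b ^+ r)^-1) (set_pred S) 0 n block_weight1 h1 block_weightS.
rewrite [block_pos _ 0]/= block_weight1 mul1r => ->.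
transitivity (\sum_(s : {ffun 'I_r -> 'S_n.+1} |
    \bigcup_(j < r) descent_set (s j) \subset S) mallows_iid q s).
  rewrite (partition_big (fun s : {ffun 'I_r -> 'S_n.+1} =>
    \bigcup_(j < r) descent_set (s j)) (fun T => T \subset S)) //=.
  apply: eq_bigr => T TS; apply: eq_bigl => s.
  by apply/esym/andb_idl => /eqP ->.
(* The union lies in [S] exactly when each descent set does, and independence turns the sum into a
   product. *)
transitivity (\prod_(j < r) \sum_(s : 'S_n.+1 | desc_in (set_pred S) s) mallows q s).
  rewrite (bigA_distr_big (@desc_in (set_pred S) n.+1)) /=; apply: eq_bigl => s.
  apply/bigcupsP/ffun_onP => H j; first by rewrite -topredE /= -descent_subset H.
  by move=> _; rewrite descent_subset; apply: H.
rewrite prodr_const card_ord mallows_desc_in -prodrXl big_ord_recl.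
rewrite exprVn h1 mul1r add0n big_mkord; apply: eq_bigr => j _.
by rewrite exprVn.
Qed.

Lemma law_ge0 S : 0 <= @descent_union_law R n.+1 q r S.
Proof.
apply: sumr_ge0 => s _; apply: prodr_ge0 => j _.
by rewrite divr_ge0 ?sumr_ge0 // => *; rewrite exprn_ge0 // ltW.
Qed.

Lemma law_sum1 : \sum_S @descent_union_law R n.+1 q r S = 1.
Proof.
rewrite (eq_bigl (fun S => S \subset [set: 'I_n]%SET)) => [|S]; last first.
  by rewrite finset.subsetT.
rewrite law_subset -block_weight1 -[RHS](word_weight_nseq_cat n [::] block_weight1) cats0.
congr word_weight; apply: (@eq_from_nth _ None); rewrite size_map size_iota ?size_nseq // => j jn.
rewrite nth_nseq jn (nth_map 0%N) ?size_iota // nth_iota //.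
by rewrite -[(0 + j)%N]/(val (Ordinal jn)) set_predE finset.inE.
Qed.

End DescentUnion.

(** * One-dependence and stationarity *)

Section Processes.
Variables (R : realType) (n : nat) (e : nat -> R) (P : {set 'I_n} -> R).
Hypothesis e1 : e 1 = 1.
Hypothesis sub_sum : forall S : {set 'I_n}, \sum_(T : {set 'I_n} | T \subset S) P T =
  word_weight e 1 [seq if set_pred S i then None else Some false | i <- iota 0 n].
Implicit Types A B J S T : {set 'I_n.+1.-1}.

Lemma correlation_word A :
  @correlation R n.+1 P A = word_weight e 1 (corr_word (set_pred A) 0 n).
Proof. exact: superset_sum_word. Qed.

Lemma one_dependent_word : @one_dependent R n.+1 P.
Proof.
move=> X Y XY; rewrite !correlation_word.
have sXY i j : set_pred X i -> set_pred Y j -> (i + 1 < j)%N || (j + 1 < i)%N.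
  move=> /set_pred_ord[x xX <-] /set_pred_ord[y yY <-].
  by have := XY x y xX yY; rewrite /site; lia.
have UE : corr_word (set_pred (X :|: Y)) 0 n =
    corr_word (predU (set_pred X) (set_pred Y)) 0 n.
  apply/eq_in_map => i; rewrite mem_iota add0n => /= ni.
  by have := set_predE (X :|: Y) (Ordinal ni); rewrite finset.in_setU -!set_predE /= => ->.
(* The first site cannot lie in both sets; the one that avoids it is put second. *)
rewrite UE; case: (boolP (set_pred Y 0)) => Y0; last first.
  exact: corr_word_weight_disjoint.
rewrite mulrC -corr_word_weight_disjoint //.
- by congr word_weight; apply: eq_map => i; rewrite /= orbC.
- by move=> i j Yi Xj; rewrite orbC sXY.
- by apply/negP => X0; have := sXY _ _ X0 Y0.
Qed.

(** Translation moves [i] letters F from the end of the word to its beginning, and e(1) = 1 makes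
    them harmless at both ends. *)
Lemma corr_word_shift (A B : nat -> bool) i :
  (i <= n)%N -> (forall j, B (i + j)%N = A j) ->
  (forall j, (j < i)%N -> B j = false) ->
  (forall j, (n <= i + j)%N -> A j = false) ->
  word_weight e 1 (corr_word B 0 n) = word_weight e 1 (corr_word A 0 n).
Proof.
move=> ni BA B0 A0; have nE : n = (i + (n - i))%N by rewrite subnKC.
have wB : corr_word B 0 n = nseq i None ++ corr_word B i (n - i).
  rewrite {1}nE /corr_word iotaD map_cat; congr (_ ++ _).
  apply: (@eq_from_nth _ None); rewrite size_map size_iota ?size_nseq // => j ji.
  by rewrite nth_nseq ji (nth_map 0%N) ?size_iota // nth_iota // B0.
have wA : corr_word A 0 n = corr_word A 0 (n - i) ++ nseq i None.
  rewrite {1}nE addnC /corr_word iotaD map_cat; congr (_ ++ _).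
  apply: (@eq_from_nth _ None); rewrite size_map size_iota ?size_nseq // => j ji.
  by rewrite nth_nseq ji (nth_map 0%N) ?size_iota // nth_iota // A0 //; lia.
rewrite wB wA word_weight_nseq_cat // word_weight_cat_nseq //.
by apply: word_weight_map_shift => j _; rewrite BA.
Qed.

Lemma in_translate (i : int) J (y : 'I_n.+1.-1) :
  reflect (exists2 x : 'I_n.+1.-1, x \in J & (y : nat)%:Z = (x : nat)%:Z + i)
    (y \in @translate n.+1 i J).
Proof.
rewrite finset.inE; apply: (iffP existsP) => [[x /andP[xJ /eqP H]]|[x xJ H]]; exists x => //.
  by move: H; rewrite /site; lia.
by rewrite xJ; apply/eqP; move: H; rewrite /site; lia.
Qed.

Lemma translatableP (i : int) J (x : 'I_n.+1.-1) :
  @translatable n.+1 i J -> x \in J ->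
  exists y : 'I_n.+1.-1, (y : nat)%:Z = (x : nat)%:Z + i.
Proof.
move=> tJ /tJ; rewrite /site /= => H.
have yn : (absz ((x : nat)%:Z + i)%R < n.+1.-1)%N by move: H => /=; lia.
by exists (Ordinal yn) => /=; lia.
Qed.

Lemma translateK (i : int) J :
  @translatable n.+1 i J -> @translate n.+1 (- i) (@translate n.+1 i J) = J.
Proof.
move=> tJ; apply/setP => z; apply/in_translate/idP => [[y /in_translate[x xJ yx] zy]|zJ].
  have zx : (z : nat) = x by move: zy; rewrite yx addrK => -[].
  by rewrite (val_inj zx : z = x).
have [y yz] := translatableP tJ zJ; exists y; last by rewrite yz addrK.
by apply/in_translate; exists z.
Qed.

Lemma translatable_translate (i : int) J : @translatable n.+1 (- i) (@translate n.+1 i J).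
Proof.
move=> y /in_translate[x _ yx]; have xn : (x < n)%N := ltn_ord x.
have -> : (@site n.+1 y)%:Z + - i = (@site n.+1 x)%:Z by move: yx; rewrite /site; lia.
by rewrite !lez_nat.
Qed.

Lemma translatableS (i : int) A B :
  A \subset B -> @translatable n.+1 i B -> @translatable n.+1 i A.
Proof. by move=> /fintype.subsetP AB tB x /AB; apply: tB. Qed.

Lemma translateS (i : int) A B :
  A \subset B -> @translate n.+1 i A \subset @translate n.+1 i B.
Proof.
move=> /fintype.subsetP AB; apply/fintype.subsetP => y /in_translate[x /AB xB yx].
by apply/in_translate; exists x.
Qed.

Lemma correlation_translate (i : int) A :
  @translatable n.+1 i A ->
  @correlation R n.+1 P (@translate n.+1 i A) = @correlation R n.+1 P A.
Proof.
have nat_case (m : nat) B : @translatable n.+1 m B ->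
    @correlation R n.+1 P (@translate n.+1 m B) = @correlation R n.+1 P B.
  move=> tB; rewrite !correlation_word.
  (* The empty set is translatable by any amount; a member of [B] bounds the shift by [n]. *)
  case: (set_0Vmem B) => [->|[b bB]].
    have -> : @translate n.+1 m finset.set0 = finset.set0 => //.
    by apply/setP => y; rewrite finset.in_set0; apply/in_translate => -[x]; rewrite finset.in_set0.
  have mn : (m <= n)%N by have := tB _ bB; rewrite /site /=; lia.
  apply: (corr_word_shift mn) => j.
  - apply/idP/idP => [/set_pred_ord[y /in_translate[x xB yx] ym]|/set_pred_ord[x xB <-]].
      have -> : j = x by lia.
      by rewrite set_predE.
    have [y yx] := translatableP tB xB.
    have -> : (m + x)%N = y by lia.
    by rewrite set_predE; apply/in_translate; exists x.
  - move=> jm; apply/negbTE/negP => /set_pred_ord[y /in_translate[x xB yx] yj]; lia.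
  - move=> nj; apply/negbTE/negP => /set_pred_ord[x xB xj].
    by have := tB _ xB; rewrite /site xj /=; lia.
case: i => m tA; first exact: nat_case.
(* A negative shift is undone by a positive one, to which the first case applies. *)
rewrite NegzE in tA *; have tA' := @translatable_translate (- m.+1%:Z) A.
by rewrite -[A in RHS](translateK tA); rewrite opprK in tA' *; rewrite nat_case.
Qed.

(** Sorting the sets above [B] by their trace on [J] links marginals to correlations. *)
Lemma marginal_upper_sum J B : B \subset J ->
  \sum_(T : {set 'I_n.+1.-1} | (B \subset T) && (T \subset J)) @marginal R n.+1 P J T =
  @correlation R n.+1 P B.
Proof.
move=> BJ; rewrite /correlation.
rewrite [RHS](partition_big (fun S => S :&: J) (fun T => (B \subset T) && (T \subset J))) /=; last first.
  by move=> S BS; rewrite finset.subsetI BS BJ finset.subsetIr.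
apply: eq_bigr => T /andP[BT TJ]; apply: eq_bigl => S.
apply/esym/andb_idl => /eqP ST; apply: fintype.subset_trans BT _.
by rewrite -ST finset.subsetIl.
Qed.

(** Möbius inversion as an induction on the size of [J :\: T]: the sums over all U between T and J
    agree by translation invariance of correlations, and the terms with U larger than T agree by
    induction. *)
Lemma stationary_word : @stationary R n.+1 P.
Proof.
move=> J i tJ T; have [k] := ubnP #|J :\: T|; elim: k T => // k IH T JT TJ.
pose m' U := @marginal R n.+1 P (@translate n.+1 i J) (@translate n.+1 i U).
have H : \sum_(U : {set 'I_n.+1.-1} | (T \subset U) && (U \subset J)) @marginal R n.+1 P J U =
    \sum_(U : {set 'I_n.+1.-1} | (T \subset U) && (U \subset J)) m' U.
  rewrite marginal_upper_sum // -(correlation_translate (translatableS TJ tJ)).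
  rewrite -(@marginal_upper_sum (@translate n.+1 i J)) ?translateS //.
  rewrite (reindex_onto (@translate n.+1 i) (@translate n.+1 (- i))) /=; last first.
    move=> U /andP[_ UJ]; rewrite -{1}[i]opprK translateK //.
    exact: translatableS UJ (@translatable_translate _ _).
  apply: eq_bigl => U; apply/andP/andP => [[/andP[TU UJ] /eqP UK]|[TU UJ]].
    rewrite -UK -{1}(translateK (translatableS TJ tJ)) translateS //.
    by rewrite -(translateK tJ) translateS.
  by rewrite !translateS // translateK //; apply: translatableS UJ tJ.
have TT : (T \subset T) && (T \subset J) by rewrite fintype.subxx.
move: H; rewrite (bigD1 T TT) [in RHS](bigD1 T TT) /=.
rewrite (eq_bigr m'); first exact: addIr.
move=> U /andP[/andP[TU UJ] UT]; apply: IH => //.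
have pTU : T \proper U by rewrite finset.properEneq eq_sym UT.
rewrite ltnS in JT; apply: leq_trans JT; apply: proper_card.
rewrite finset.properEneq finset.setDS // andbT.
apply: contraNneq UT => UTE; apply/eqP; apply/setP => x.
case: (boolP (x \in J)) => xJ.
  by move/setP/(_ x): UTE; rewrite !finset.in_setD xJ !andbT => /negb_inj.
have notin (V : {set 'I_n.+1.-1}) : V \subset J -> (x \in V) = false.
  by move=> /fintype.subsetP VJ; apply: contraNF xJ => /VJ.
by rewrite !notin.
Qed.

End Processes.

(** * Products and inverses of Laurent series *)

Section LaurentSeries.
Variable R : fieldType.
Implicit Types (a b : nat -> R) (f g : int -> R) (N : int).

(* z^N * sum_j a(j) z^j *)
Definition shifted a N : int -> R := fun m => if m - N is Posz j then a j else 0.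

Lemma shifted_lt a N m : m < N -> shifted a N m = 0.
Proof. by rewrite /shifted -subr_lt0; case: (m - N). Qed.

Lemma shifted_add a N (j : nat) : shifted a N (N + j%:Z) = a j.
Proof. by rewrite /shifted addrC addKr. Qed.

Lemma int_split N m : m < N \/ exists j : nat, m = N + j%:Z.
Proof.
case: (ltP m N) => [|Nm]; [by left|right].
by exists (absz (m - N)%R); lia.
Qed.

Lemma laurent_mulE f g N N' (M : nat) :
  (forall m, m < N -> f m = 0) -> (forall m, m < N' -> g m = 0) ->
  laurent_mul f g (N + N' + M%:Z) =
  \sum_(i < M.+1) f (N + i%:Z) * g (N' + (M - i)%N%:Z).
Proof.
move=> fN gN; rewrite /laurent_mul.
rewrite (fsbigE [seq N + i%:Z | i : nat <- index_iota 0 M.+1]) //; first last.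
- move=> m _ mN; case: (int_split N m) => [/fN -> |[j mE]]; first by rewrite mul0r.
  rewrite mE gN ?mulr0 //; have Mj : (M < j)%N.
    rewrite ltnNge; apply: contra mN => jM; rewrite mE.
    by apply/mapP; exists j; rewrite ?mem_index_iota.
  by lia.
- by rewrite map_inj_uniq ?iota_uniq // => i j /addrI [].
rewrite big_mkcond big_map big_mkord; apply: eq_bigr => i _.
rewrite in_setT; congr (_ * g _).
by have := ltn_ord i; lia.
Qed.

Lemma laurent_mul_lt f g N N' m :
  (forall m, m < N -> f m = 0) -> (forall m, m < N' -> g m = 0) ->
  m < N + N' -> laurent_mul f g m = 0.
Proof.
move=> fN gN mN; apply: fsbig1 => i _.
by case: (ltP i N) => iN; [rewrite fN ?mul0r | rewrite gN ?mulr0 //; lia].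
Qed.

(** Both inverses vanish below a common degree [L]; from there on, the series [f] with leading
    coefficient 1 cancels by [conv_inj]. *)
Lemma laurent_inverse_uniq f g g' N :
  (forall m, m < N -> f m = 0) -> f N = 1 ->
  laurent_inverse f g -> laurent_inverse f g' -> g = g'.
Proof.
move=> fN f1 [_ [M gM] fg] [_ [M' gM'] fg'].
pose L := Order.min M M'.
have gL m : m < L -> g m = 0 by rewrite lt_min => /andP[/gM].
have gL' m : m < L -> g' m = 0 by rewrite lt_min => /andP[_ /gM'].
have H : (fun j : nat => g (L + j%:Z)) =1 (fun j : nat => g' (L + j%:Z)).
  apply: (@conv_inj _ (fun j : nat => f (N + j%:Z))) => [|j].
    by rewrite addr0.
  by rewrite -!laurent_mulE // fg fg'.
apply: functional_extensionality_dep => m.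
case: (int_split L m) => [mL|[j ->]]; last exact: H.
by rewrite gL ?gL'.
Qed.

Lemma laurent_inverse_shifted a b N :
  (forall m, \sum_(i < m.+1) a i * b (m - i)%N = (m == 0)%:R) ->
  laurent_inverse (shifted a N) (shifted b (- N)).
Proof.
move=> ab; split; [by exists N; apply: shifted_lt | by exists (- N); apply: shifted_lt |].
apply: functional_extensionality_dep => m; rewrite /laurent_one.
case: (int_split 0 m) => [m0|[j ->]].
  rewrite (@laurent_mul_lt _ _ N (- N)); try exact: shifted_lt.
    by rewrite lt_eqF.
  by rewrite subrr.
rewrite -[0 in LHS](subrr N) laurent_mulE; try exact: shifted_lt.
under eq_bigr do rewrite !shifted_add.
by rewrite ab add0r.
Qed.

Lemma conv_sym a b m :
  \sum_(i < m.+1) a i * b (m - i)%N = \sum_(i < m.+1) b i * a (m - i)%N.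
Proof.
rewrite (reindex_inj rev_ord_inj) /=; apply: eq_bigr => i _.
by rewrite mulrC subSS subKn // -ltnS.
Qed.

End LaurentSeries.

(** * The correlation kernel *)

Section Kernel.
Variables (R : realFieldType) (q : R) (r : nat).
Let e : nat -> R := block_weight q r.

(* (1 - 1/e^(z)) / z *)
Definition gap_series l : R := - series_inv e l.+1.
Definition kernel_series : nat -> R := series_inv gap_series.
Definition kernel : int -> R := shifted kernel_series (-1).

Lemma gap_series0 : gap_series 0 = 1.
Proof. by rewrite /gap_series /= expr1 mulN1r opprK /e block_weight1. Qed.

(** Both sides are inverse to [kernel_series]. *)
Lemma kernel_series_inv : series_inv kernel_series =1 gap_series.
Proof.
apply: (@conv_inj _ kernel_series) => [|m] //.
by rewrite series_invP // -conv_sym series_invP // gap_series0.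
Qed.

(** Up to a common sign, both sides are the coefficient of degree l + 1 in [gap_series]. *)
Lemma kernel_series_run l :
  word_weight kernel_series 1 (run l) = word_weight e 1 (run l.+1).
Proof.
have := kernel_series_inv l.+1; rewrite /gap_series [LHS]/= => H.
apply: (can_inj (signrMK l.+1)); rewrite H [series_inv _ _]/=.
by rewrite [in LHS]exprS mulN1r mulNr opprK.
Qed.

Lemma kernel_unique : unique (is_k_hat q r) kernel.
Proof.
have eE : e_hat q r = shifted e 0.
  by apply: functional_extensionality_dep => m; rewrite /shifted subr0.
have eK : laurent_inverse (e_hat q r) (shifted (series_inv e) 0).
  rewrite eE -[0 in X in laurent_inverse _ X]oppr0; apply: laurent_inverse_shifted => m.
  by rewrite series_invP // /e block_weight0.
(* The constant term of 1 - 1/E(z) cancels, so a factor z comes out; its inverse therefore starts in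
   degree -1. *)
have fE : laurent_sub (@laurent_one R) (shifted (series_inv e) 0) = shifted gap_series 1.
  apply: functional_extensionality_dep => m; rewrite /laurent_sub /laurent_one.
  case: (int_split 0 m) => [m0|[j ->]].
    by rewrite !shifted_lt ?lt_eqF ?subrr // (lt_trans m0).
  rewrite shifted_add add0r; case: j => [|j]; first by rewrite subrr shifted_lt.
  by rewrite sub0r -[LHS]/(gap_series j) -(shifted_add gap_series 1); congr shifted; lia.
have gK : laurent_inverse (shifted gap_series 1) kernel.
  by apply: laurent_inverse_shifted => m; rewrite series_invP // gap_series0.
split; first by exists (shifted (series_inv e) 0); rewrite ?fE.
move=> k' [f ef fk'].
have {ef}ff : f = shifted (series_inv e) 0.
  apply: (laurent_inverse_uniq (N := 0)) ef eK; first by case.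
  by rewrite /= -[RHS](block_weight0 q r).
rewrite {}ff fE in fk'.
apply: (laurent_inverse_uniq (N := 1)) gK fk'; first exact: shifted_lt.
by rewrite -[1 in LHS]addr0 shifted_add gap_series0.
Qed.

End Kernel.

Lemma mass_det (R : realFieldType) (q : R) (n r : nat) (S : {set 'I_n}) :
  (0 < r)%N ->
  word_weight (block_weight q r) 1 [seq Some (set_pred S i) | i <- iota 0 n] =
  \det (@descent_union_mx R n.+1 q r S).
Proof.
move=> r0; set L := rcons [seq i.+1 | i <- iota 0 n & set_pred S i] n.+1.
have LE : @augmented_sites n.+1 S = 0%N :: L.
  by rewrite /augmented_sites /L -(map_val_enum S) -map_comp.
have sL : size L = #|S|.+1.
  by rewrite size_rcons -(map_val_enum S) !size_map -cardE.
have ltL : sorted ltn L.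
  have -> : L = map succn (rcons [seq i <- iota 0 n | set_pred S i] n) by rewrite map_rcons.
  rewrite (mono_sorted (e := ltn)) //.
  apply: (subseq_sorted ltn_trans _ (iota_ltn_sorted 0 n.+1)).
  by rewrite -addn1 iotaD -cats1 cat_subseq // filter_subseq.
rewrite -[1%N]subn0 (@word_weight_hess _ _ (set_pred S) 0 0) ?block_weight0 //=.
rewrite add0n -/L.
case: L LE sL ltL => // c L LE [sL] cL; rewrite [head _ _]/= [behead _]/=.
(* The rows are indexed by all augmented sites but the last, the columns by all but the first. *)
have -> : zip (c :: L) L = zip (belast c L) L.
  by elim: L c {LE sL cL} => //= d L IH c; rewrite IH.
have nthL i : (i < (size L).+1)%N ->
    nth 0%N (0%N :: unzip1 (zip (belast c L) L)) i = nth 0%N (0%N :: c :: L) i.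
  move=> iL; rewrite unzip1_zip ?size_belast // -[_ :: belast c L]/(belast 0%N (c :: L)).
  by rewrite [in RHS]lastI nth_rcons size_belast iL.
rewrite (@hess_det _ _ _ 0%N) ?size_zip ?size_belast ?minnn; last first.
  move=> i j ji iL; rewrite nthL // unzip2_zip ?size_belast // toeplitz_eq0 //.
  case: i ji iL => // i ji iL; rewrite [nth _ (_ :: _) _.+1]/=.
  by apply: (sorted_ltn_nth ltn_trans); rewrite ?inE //=; lia.
apply: det_eq_entries => [|i j i' j' ii' jj']; first by rewrite sL.
have iL := ltn_ord i.
rewrite !mxE nthL // unzip2_zip ?size_belast // LE ii' jj' [nth _ _ j'.+1]/=.
move: (nth _ _ i') (nth _ _ j') => x y; rewrite /toeplitz /inv_qfact.
case: leqP => xy; first by rewrite subzn // exprVn.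
have: y%:Z - x%:Z < 0 by rewrite subr_lt0 ltz_nat.
(* A negative index gives 0 to the power [r], which is 0 because [r] is positive. *)
by case: (_ - _) => // m _; rewrite expr0n; case: r r0.
Qed.

Theorem theorem5p5 (R : realType) (n r : nat) (q : R)
    (hn : (2 <= n)%N) (hr : (1 <= r)%N) (hq0 : 0 < q) (hq1 : q <= 1) :
  let P : {set 'I_n.-1} -> R := @descent_union_law R n q r in
  (forall S : {set 'I_n.-1}, P S = \det (descent_union_mx q r S)) /\
  point_process P /\
  stationary P /\
  one_dependent P /\
  (exists k : int -> R, unique (is_k_hat q r) k /\
     determinantal P
       (fun x y : 'I_n.-1 => k ((site y)%:Z - (site x)%:Z))).
Proof.
case: n hn => // n hn P; have law := @law_subset R q n r hq0; have e1 := block_weight1 q r.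
split; first by move=> S; rewrite -mass_det // -(mass_word law).
split; first by split; [exact: law_ge0 | exact: law_sum1].
split; first exact: (stationary_word e1 law).
split; first exact: (one_dependent_word e1 law).
exists (kernel q r); split; first exact: kernel_unique.
move=> A; rewrite (correlation_word law).
have sE : [seq i <- iota 0 n | set_pred A i] = [seq val i | i <- enum A] by rewrite map_val_enum.
rewrite (corr_word_det e1 _ (kernel_series_run q r)) ?sE; last by [].
rewrite corr_det_det; last first.
  by rewrite -sE; apply: (sorted_filter ltn_trans); apply: iota_ltn_sorted.
apply: det_eq_entries; first by rewrite size_map -cardE.
move=> i j i' j' ii' jj'; rewrite !mxE.
have valA k (k' : 'I_#|A|) : k = k' :> nat -> nth 0%N [seq val i0 | i0 <- enum A] k = enum_val k'.
  by move=> ->; rewrite (nth_map (enum_val k')) -?cardE // -enum_val_nth.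
rewrite (valA _ _ ii') (valA _ _ jj') /site /kernel /toeplitz.
(* The zeros of [toeplitz] are the coefficients of the kernel below degree -1. *)
case: leqP => ij; last by rewrite shifted_lt //; lia.
by rewrite -(shifted_add _ (-1)); congr shifted; lia.
Qed.
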